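(* Let $\alpha\in[0,1]$ and let $\beta=\mathbb{P}\bigl(\omega_t^\star\notin\widehat\Omega_t\bigr)$ be the probability that the proposed support misses the true world. Suppose that, conditionally on the event $\{\omega_t^\star\in\widehat\Omega_t\}$ that the true world is proposed, the true world is retained with probability at least $1-\alpha$, i.e. $\mathbb{P}(\omega_t^\star\in\mathcal{W}_t\mid\omega_t^\star\in\widehat\Omega_t)\ge 1-\alpha$ (a condition regarded as vacuous if $\beta=1$). Suppose the controller commits only to actions $a$ with $\mathcal{U}_t(a)=\emptyset$. Then $$\mathbb{P}(\text{unsafe commit})\le\beta+(1-\beta)\alpha\le\alpha+\beta ,$$ where ''unsafe commit'' is the event that the controller commits to an action $a_t$ with $a_t\notin\Gamma_t(\omega_t^\star)$.
   Context: All random objects live on a common probability space, and all events mentioned are assumed measurable. At the decision step $t$ there are: a set $\mathcal{A}_t$ of candidate actions; a latent world space $\Omega_t$; a true world $\omega_t^\star\in\Omega_t$ (random); a proposed support $\widehat\Omega_t\subseteq\Omega_t$ (random, computed from the agent's history); a plausible-world (retained) set $\mathcal{W}_t\subseteq\widehat\Omega_t$ (random); and, for each world $\omega\in\Omega_t$, a set $\Gamma_t(\omega)\subseteq\mathcal{A}_t$ of actions that are safely admissible in $\omega$. For $a\in\mathcal{A}_t$ the uncertified region is $$\mathcal{U}_t(a)=\{\omega\in\mathcal{W}_t: a\notin\Gamma_t(\omega)\}.$$ The controller either commits to some action $a_t\in\mathcal{A}_t$ or returns a fallback, in which case no action is committed. *)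

(* Defs.v *)
From mathcomp Require Import all_boot all_order all_algebra.
From mathcomp Require Import all_classical all_reals all_analysis.

Set Implicit Arguments.
Unset Strict Implicit.
Unset Printing Implicit Defensive.

Import Order.TTheory GRing.Theory Num.Theory.

Local Open Scope classical_set_scope.
Local Open Scope ring_scope.

(* P(A | B).  Meaningful only when P B is nonzero: since x / 0 = 0, it is 0
   when P B = 0. *)
Definition condp (d : measure_display) (T : measurableType d) (R : realType)
    (P : probability T R) (A B : set T) : R :=
  fine (P (A `&` B)) / fine (P B).

(* A random world is a map T -> Omega and a random set of worlds a map
   T -> set Omega, on the sample space T.  No sigma-algebra is put on Omega:
   measurability is only ever assumed of the events below. *)
Definition lies_in (T Omega : Type) (w : T -> Omega) (S : T -> set Omega) :
    set T :=
  [set s | S s (w s)].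

Definition uncertified (T Omega A : Type) (W : T -> set Omega)
    (Gamma : Omega -> set A) (s : T) (a : A) : set Omega :=
  [set w | W s w /\ ~ Gamma w a].

(* The decision is [Some a] when the controller commits to [a], and [None] when
   it returns the fallback. *)
Definition unsafe_commit (T Omega A : Type) (wstar : T -> Omega)
    (Gamma : Omega -> set A) (act : T -> option A) : set T :=
  [set s | exists2 a, act s = Some a & ~ Gamma (wstar s) a].

(* Main.v *)
(* On an unsafe commit, a retained true world would lie in the uncertified
   region of the committed action, which is empty: the true world has been
   lost. It was either never proposed, with probability beta, or proposed and
   then discarded, with probability at most (1 - beta) * alpha. *)

Require Import Defs.
From mathcomp Require Import all_boot all_order all_algebra.
From mathcomp Require Import all_classical all_reals all_analysis.
From mathcomp Require Import lra.

Set Implicit Arguments.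
Unset Strict Implicit.
Unset Printing Implicit Defensive.

Import Order.TTheory GRing.Theory Num.Theory.

Local Open Scope classical_set_scope.
Local Open Scope ring_scope.

Lemma unsafe_commit_sub_lost (T Omega A : Type) (wstar : T -> Omega)
    (W : T -> set Omega) (Gamma : Omega -> set A) (act : T -> option A) :
  (forall s a, act s = Some a -> uncertified W Gamma s a = set0) ->
  unsafe_commit wstar Gamma act `<=` ~` lies_in wstar W.
Proof.
move=> certified s [a acts unsafe] retained.
suff : uncertified W Gamma s a (wstar s) by rewrite (certified _ _ acts).
by split.
Qed.

Lemma condp_mulE (d : measure_display) (T : measurableType d) (R : realType)
    (P : probability T R) (A B : set T) :
  fine (P B) != 0 -> condp P A B * fine (P B) = fine (P (A `&` B)).
Proof. by move=> PB0; rewrite /condp divfK. Qed.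

Theorem mainTheorem2 (R : realType) (d : measure_display)
    (T : measurableType d) (P : probability T R)
    (Omega A : Type)
    (wstar : T -> Omega) (What W : T -> set Omega)
    (Gamma : Omega -> set A) (act : T -> option A)
    (alpha beta : R)
    (W_sub : forall s, W s `<=` What s)
    (meas_proposed : measurable (lies_in wstar What))
    (meas_retained : measurable (lies_in wstar W))
    (meas_unsafe : measurable (unsafe_commit wstar Gamma act))
    (alpha01 : 0 <= alpha <= 1)
    (betaE : P (~` lies_in wstar What) = beta%:E)
    (retention : beta <> 1 ->
       1 - alpha <= condp P (lies_in wstar W) (lies_in wstar What))
    (commit_certified : forall s a,
       act s = Some a -> uncertified W Gamma s a = set0) :
  (P (unsafe_commit wstar Gamma act) <= (beta + (1 - beta) * alpha)%:E)%E /\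
  beta + (1 - beta) * alpha <= alpha + beta.
Proof.
case/andP: alpha01 => alpha0 alpha1.
have beta0 : 0 <= beta by rewrite -lee_fin -betaE.
have beta1 : beta <= 1.
  by rewrite -lee_fin -betaE; apply: probability_le1; exact: measurableC.
(* The two bounds differ by [alpha * beta], a product of nonnegative reals. *)
split; last by nra.
have PpropE : fine (P (lies_in wstar What)) = 1 - beta.
  rewrite -[lies_in _ _]setCK probability_setC; last exact: measurableC.
  by rewrite betaE.
(* Retained worlds are all proposed, so the numerator of the conditional probability is the plain
   probability of retention. *)
have retI : lies_in wstar W `&` lies_in wstar What = lies_in wstar W.
  by apply/setIidPl => s; exact: W_sub.
(* Clearing the denominator gives a form of [retention] that survives [beta = 1]: there the
   hypothesis says nothing, but the left side is 0. *)
have Pret : (1 - alpha) * (1 - beta) <= fine (P (lies_in wstar W)).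
  have [->|/eqP beta_neq1] := eqVneq beta 1.
    by rewrite subrr mulr0 fine_ge0.
  have p0 : fine (P (lies_in wstar What)) != 0.
    by rewrite PpropE subr_eq0 eq_sym; exact/eqP.
  rewrite -[in leRHS]retI -condp_mulE// PpropE ler_wpM2r ?subr_ge0//.
  exact: retention.
apply: (@le_trans _ _ (P (~` lies_in wstar W))).
  apply: le_measure; rewrite ?inE//; first exact: measurableC.
  exact: unsafe_commit_sub_lost.
(* By [Pret], the loss probability is at most [1 - (1 - alpha) * (1 - beta)], which expands to
   [beta + (1 - beta) * alpha]; [fineK] moves the comparison into [R]. *)
rewrite probability_setC// -(fineK (fin_num_measure P _ meas_retained)).
by rewrite -EFinB lee_fin; nra.
Qed.
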